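(* Let $n_x\ge 1$ be an integer and let $\mathrm{Pr}_{\mathbb W}$ be a probability distribution on $\mathbb R^{n_x}\times\mathbb R$, the distribution of a random vector $w=(x,y)$. Let $T:\mathbb R^{n_x}\to\mathbb R$ and $\hat\sigma:\mathbb R^{n_x}\to(0,\infty)$ be given (fixed, not depending on the samples below) measurable functions, and let $\varepsilon\in(0,1)$ and $\delta\in(0,1)$. Let $N$ be an integer with $$N\ge\frac{7.47}{\varepsilon}\ln\frac1\delta ,\qquad\text{and let}\qquad r=\left\lfloor\frac{\varepsilon N}{2}\right\rfloor,$$ with $r\ge 1$. Draw $N$ i.i.d. samples $\{(x_i,y_i)\}_{i=1}^N$ from $\mathrm{Pr}_{\mathbb W}$, compute $$\gamma_i=\frac{|y_i-T(x_i)|}{\hat\sigma(x_i)},\quad i=1,\dots,N,\qquad\text{and let}\qquad \bar\gamma=\mathrm{max}^{(r)}\{\gamma_i\}_{i=1}^N .$$ Then, with probability no smaller than $1-\delta$ with respect to the draw of the $N$ samples, $$\mathrm{Pr}_{\mathbb W}\{|y-T(x)|>\bar\gamma\,\hat\sigma(x)\}\le\varepsilon.$$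
   Context: Generalized max: for a collection of $N$ scalars $\{q_i\}_{i=1}^N$ (counted with multiplicity) and an integer $1\le r\le N$, $\mathrm{max}^{(r)}\{q_i\}_{i=1}^N$ denotes the $r$-th largest value of the collection: $\mathrm{max}^{(1)}$ is the largest value, $\mathrm{max}^{(2)}$ the second largest, and so on, with $\mathrm{max}^{(N)}$ the smallest. In particular, no more than $r-1$ elements are strictly larger than it. The function $\hat\sigma$ is meant as an estimator of the conditional quantity $\sqrt{\mathbb E\{(y-T(x))^2\mid x\}}$, but no accuracy of this estimate is assumed; it is only required to be strictly positive. The samples are i.i.d. with law $\mathrm{Pr}_{\mathbb W}$, so ''with probability no smaller than $1-\delta$'' refers to the product measure $\mathrm{Pr}_{\mathbb W}^{\otimes N}$ on the multisample. In the inner probability $\mathrm{Pr}_{\mathbb W}\{\cdot\}$, $(x,y)$ is a fresh random vector with law $\mathrm{Pr}_{\mathbb W}$ and $\bar\gamma$ is held fixed. *)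

(* Defs.v *)
From HB Require Import structures.
From mathcomp Require Import all_boot all_order all_algebra.
From mathcomp Require Import all_classical all_reals all_analysis.

Set Implicit Arguments.
Unset Strict Implicit.
Unset Printing Implicit Defensive.

Import Order.TTheory GRing.Theory Num.Theory.

Local Open Scope classical_set_scope.
Local Open Scope ring_scope.

(* max^(r) is 1-based: r = 1 gives the largest entry of q and r = size q the
   smallest, repetitions counted; the definition is meaningful for
   1 <= r <= size q only. *)
Definition rmax (R : realType) (r : nat) (q : seq R) : R :=
  nth 0 (sort >=%R q) r.-1.

Lemma count_gt_rmax (R : realType) (r : nat) (q : seq R) :
  (0 < r <= size q)%N ->
  (count (fun x => (rmax r q < x)%R) q < r)%N
  /\ (r <= count (fun x => (rmax r q <= x)%R) q)%N.
Proof.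
case: r => // r /= rq; rewrite /rmax /=.
set s := sort _ q; set m := nth 0 s r.
have ss : sorted >=%R s by apply: sort_sorted => x y; exact: le_total.
have rs : (r < size s)%N by rewrite size_sort.
have cE a : count a q = (count a (take r.+1 s) + count a (drop r.+1 s))%N.
  by rewrite -count_cat cat_take_drop (permP (permEl (perm_sort _ _))).
have cE' a : count a q = (count a (take r s) + count a (drop r s))%N.
  by rewrite -count_cat cat_take_drop (permP (permEl (perm_sort _ _))).
have trge : transitive (>=%R : rel R) by move=> a b c /[swap]; exact: le_trans.
have mono i j : (i <= j < size s)%N -> nth 0 s j <= nth 0 s i.
  move=> /andP[ij js].
  apply: (sorted_leq_nth trge (@lexx _ R) 0 ss) => //.
  exact: leq_ltn_trans js.
split.
- rewrite cE' (_ : count _ (drop r s) = 0%N) ?addn0.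
    by rewrite ltnS (leq_trans (count_size _ _))// size_take rs.
  apply/eqP; rewrite -leqn0 leqNgt -has_count; apply/(has_nthP 0) => -[i].
  rewrite size_drop nth_drop => ilt; apply/negP; rewrite -leNgt.
  by apply: mono; rewrite leq_addr -ltn_subRL.
- rewrite cE (leq_trans _ (leq_addr _ _))//.
  rewrite (_ : count _ _ = size (take r.+1 s)).
    by rewrite size_take; case: ifP.
  apply/eqP; rewrite -all_count; apply/(all_nthP 0) => i.
  rewrite size_take => ilt.
  have ir : (i < r.+1)%N.
    move: ilt; case: ifP => // /negbT; rewrite -leqNgt => h h'.
    exact: leq_trans h' h.
  by rewrite nth_take//; apply: mono; rewrite -ltnS ir.
Qed.

Section power_probability.
Context d (T : measurableType d) (R : realType).

Definition tcons n (w : T * n.-tuple T) : n.+1.-tuple T := [tuple of w.1 :: w.2].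

Lemma measurable_tcons n : measurable_fun setT (@tcons n).
Proof. exact: measurable_cons. Qed.

HB.instance Definition _ n := isMeasurableFun.Build _ _ _ _
  (@tcons n) (@measurable_tcons n).

Variable P : probability T R.

(* The n-fold product measure of P, i.e. the law of n i.i.d. draws from P. *)
Fixpoint power_probability n : probability (n.-tuple T) R :=
  if n is n'.+1 then
    distribution (P \x power_probability n')%E (@tcons n')
  else \d_[tuple].

Lemma power_probability_rect n (A : 'I_n -> set T) :
  (forall i, measurable (A i)) ->
  power_probability n [set s | forall i, A i (tnth s i)]
  = (\prod_(i < n) P (A i))%E.
Proof.
elim: n A => [|n IHn] A mA /=.
  by rewrite big_ord0 diracE mem_set// => -[].
rewrite /distribution /pushforward big_ord_recl -IHn//.
rewrite -product_measure1E//; last first.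
  rewrite (_ : mkset _ = \big[setI/setT]_(i < n)
      ((@tnth _ T ^~ i) @^-1` A (lift ord0 i))).
    apply: bigsetI_measurable => i _.
    by rewrite -[X in measurable X]setTI; exact: measurable_tnth.
  rewrite -bigcap_seq; apply/seteqP; split => t /= h i //=.
  by apply: h; rewrite /= mem_index_enum.
congr (_ _); apply/seteqP; split => -[x t] /=.
  move=> h; split=> [|i]; first exact: (h ord0).
  by have := h (lift ord0 i); rewrite tnthS.
move=> [h0 h] i; case: (unliftP ord0 i) => [j|] ->; last exact: h0.
by rewrite tnthS; exact: h.
Qed.

End power_probability.

(* Main.v *)
(* Let X = |y - T x| / sigma x and let q be the least t with P (X > t) <= eps.
   Right continuity gives P (X > t) <= eps iff q <= t, while continuity from
   above gives P (X >= q) >= eps.  Hence the claim about max^(r) fails exactly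
   when fewer than r samples satisfy X >= q, and Chernoff's bound with
   exponential parameter ln 2 gives this event probability at most
   2^r (1 - eps / 2)^N <= 2^(eps N / 2) exp (- eps N / 2)
                       <= exp (- eps N / 7.47) <= delta. *)
Require Import Defs.
From HB Require Import structures.
From mathcomp Require Import all_boot all_order all_algebra.
From mathcomp Require Import all_classical all_reals all_analysis.
From mathcomp Require Import measurable_realfun ring lra.

Import Order.TTheory GRing.Theory Num.Theory.

Local Open Scope classical_set_scope.
Local Open Scope ring_scope.


Lemma measurable_count_lt d (T : measurableType d) (A : pred T) n r :
  measurable [set x | A x] ->
  measurable [set s : n.-tuple T | (count A s < r)%N].
Proof.
move=> mA; elim: n r => [|n IHn] r.
  case: r => [|r].
    by rewrite (_ : mkset _ = set0)//; apply/seteqP; split.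
  rewrite (_ : mkset _ = setT)//; apply/seteqP; split=> // s _ /=.
  by rewrite tuple0.
have mh : measurable [set s : n.+1.-tuple T | A (thead s)].
  by rewrite -[X in measurable X]setTI; exact: (measurable_tnth ord0 measurableT mA).
have mb k : measurable [set s : n.+1.-tuple T | (count A (behead s) < k)%N].
  by rewrite -[X in measurable X]setTI; exact: (measurable_behead measurableT (IHn k)).
(* Split on whether the first sample satisfies [A]. At [r = 0] the truncated [r.-1] is harmless:
   both pieces are empty, as is the event. *)
rewrite (_ : mkset _ =
    ([set s : n.+1.-tuple T | A (thead s)] `&`
     [set s : n.+1.-tuple T | (count A (behead s) < r.-1)%N])
    `|` (~` [set s : n.+1.-tuple T | A (thead s)] `&`
     [set s : n.+1.-tuple T | (count A (behead s) < r)%N])).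
  by apply: measurableU; apply: measurableI => //; exact: measurableC.
apply/seteqP; split=> s /=; case/tupleP: s => x s; rewrite theadE /=.
  case: (A x) => /=; last by right.
  by case: r => // r; left.
by case: (A x) => -[] [] //= _; case: r.
Qed.

(* Chernoff's bound, by induction on n: conditioning on the first sample
   multiplies the bound by p / 2 + (1 - p) = 1 - p / 2. *)
Lemma power_probability_count_lt d (T : measurableType d) (R : realType)
    (P : probability T R) (A : pred T) n r :
  measurable [set x | A x] ->
  (power_probability P n [set s : n.-tuple T | (count A s < r)%N] <=
   (2 ^+ r * (1 - fine (P [set x | A x]) / 2) ^+ n)%:E)%E.
Proof.
move=> mA; set p := fine _.
have pE : P [set x | A x] = p%:E by rewrite fineK// fin_num_measure.
have p01 : 0 <= p <= 1.
  by rewrite -!lee_fin -pE measure_ge0 probability_le1.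
elim: n r => [|n IHn] r.
  rewrite expr0 mulr1 (le_trans (probability_le1 _ _))//.
    exact: measurable_count_lt.
  by rewrite lee_fin exprn_ege1// ler1n.
(* The case [r = 0] is set apart because the halving of the bound after a first sample in [A] rests
   on [2 ^+ r.-1] being half of [2 ^+ r]. *)
have [->|r0] := posnP r.
  rewrite (_ : mkset _ = set0); last by apply/seteqP; split.
  rewrite measure0 lee_fin mulr_ge0// exprn_ge0//; lra.
rewrite [X in (X <= _)%E](_ : _ =
  (P \x power_probability P n)%E (@tcons d T n @^-1`
     [set s : n.+1.-tuple T | (count A s < r)%N]))//.
rewrite (_ : _ @^-1` _ =
    ([set x | A x] `*` [set s : n.-tuple T | (count A s < r.-1)%N])
    `|` (~` [set x | A x] `*` [set s : n.-tuple T | (count A s < r)%N])).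
  rewrite measureU; last 3 first.
  - by apply: measurableX => //; exact: measurable_count_lt.
  - apply: measurableX; first exact: measurableC.
    exact: measurable_count_lt.
  - by apply/seteqP; split=> -[x s]//= [[? _] []].
  have PX B k : measurable B ->
      (P \x power_probability P n)%E
        (B `*` [set s : n.-tuple T | (count A s < k)%N]) =
      (P B * power_probability P n [set s : n.-tuple T | (count A s < k)%N])%E.
    by move=> mB; apply: product_measure1E => //; exact: measurable_count_lt.
  rewrite /= !PX//; last exact: measurableC.
  rewrite probability_setC// pE.
  apply: (@le_trans _ _ (p%:E * (2 ^+ r.-1 * (1 - p / 2) ^+ n)%:E
     + (1 - p%:E) * (2 ^+ r * (1 - p / 2) ^+ n)%:E)%E).
    by apply: leeD; apply: lee_wpmul2l => //; rewrite -?EFinB lee_fin; lra.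
  rewrite -EFinB -!EFinM -EFinD lee_fin.
  by case: r r0 => // r _ /=; rewrite !exprS; nra.
apply/seteqP; split=> -[x s] /=.
  case: (A x) => /=; last by right.
  by case: r r0 => // r _; left.
by case: (A x) => -[] [] //= _; case: r r0.
Qed.

(** The quantile is the infimum of the up-closed set [E]. The law of [X] may have an atom at [q], so
    the second bound concerns the closed half-line, while [ccdf] measures the open one. *)
Lemma ccdf_upper_quantile d (T : measurableType d) (R : realType)
    (P : probability T R) (X : {RV P >-> R}) (eps : R) : 0 < eps < 1 ->
  exists2 q, (forall t, (ccdf X t <= eps%:E)%E = (q <= t)) &
             (eps%:E <= P [set x | (q <= X x)%R])%E.
Proof.
move=> /andP[e0 e1]; pose E := [set t | (ccdf X t <= eps%:E)%E].
have Eup s t : E s -> s <= t -> E t.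
  by move=> Es st; apply: le_trans Es; exact: ccdf_nonincreasing.
(* The infimum is finite: the tail tends to 0 at +oo and [eps > 0] gives a point of [E]; it tends to
   1 at -oo and [eps < 1] bounds [E] below. *)
have E0 : E !=set0.
  have e0' : (0 < eps%:E)%E by rewrite lte_fin.
  have [M [_ ltM]] := cvg_ccdfy0 X (open_ereal_lt' e0').
  by exists (M + 1); apply/ltW/ltM; rewrite ltrDl.
have Elb : has_lbound E.
  have e1' : (eps%:E < 1)%E by rewrite lte_fin.
  have [M [_ gtM]] := cvg_ccdfNy1 X (open_ereal_gt' e1').
  by exists M => t Et; rewrite leNgt; apply/negP => /gtM/=; rewrite ltNge Et.
have Eq : E (inf E).
  have rc : ccdf X t @[t --> (inf E)^'+] --> ccdf X (inf E).
    exact: ccdf_right_continuous.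
  apply: (cvge_to_le rc).
  near=> t; have : inf E < t by near: t; exact: nbhs_right_gt.
  by move=> /(inf_lt E0)[s Es /ltW]; exact: Eup Es.
have Eiff t : (ccdf X t <= eps%:E)%E = (inf E <= t).
  by apply/idP/idP => [|/(Eup _ _ Eq)//]; exact: ge_inf.
exists (inf E) => //; set q := inf E.
(* These events decrease to [X >= q], and each has probability above [eps] because its endpoint lies
   strictly below [q]. *)
pose F n := X @^-1` `]q - n.+1%:R^-1, +oo[.
have mF n : measurable (F n) by exact: measurable_funPTI.
rewrite (_ : mkset _ = \bigcap_n F n); last first.
  apply/seteqP; split=> x /= h.
    by move=> n _; rewrite /F /= in_itv/= andbT ltrBlDr ltr_pwDr// invr_gt0.
  rewrite leNgt; apply/negP => /ltr_add_invr[n].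
  by rewrite -ltrBrDr => /ltW; rewrite leNgt; have := h n I;
    rewrite /F /= in_itv/= andbT => ->.
apply: (@cvge_to_ge _ \oo _ _ (P \o F)).
  apply: nonincreasing_cvg_mu => //.
  - exact: le_lt_trans (probability_le1 _ _) (ltry _).
  - exact: bigcap_measurable.
  - move=> m n mn; apply/subsetPset => x; rewrite /F /= !in_itv/= !andbT.
    by apply: le_lt_trans; rewrite lerB// lef_pV2 ?posrE// ler_nat.
apply: nearW => n /=; apply/ltW; rewrite ltNge.
have := Eiff (q - n.+1%:R^-1); rewrite /ccdf /distribution /pushforward => ->.
by rewrite -ltNge ltrBlDr ltrDl invr_gt0.
Unshelve. all: by end_near. Qed.

(* The constant 7.47 enters through 2 <= expR (1 - 2 / 7.47). *)
Lemma expr2_mul_expRN_le (R : realType) (x : R) (r : nat) : r%:R <= x ->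
  2 ^+ r * expR (- x) <= expR (- (2 * (100 / 747)) * x).
Proof.
move=> rx; set c : R := 1 - 2 * (100 / 747).
have c2 : 2 <= expR c.
  (* The tangent bound [1 + c] is less than 2; applied to [c / 8] and raised to the eighth power, it
     is sharp enough. *)
  apply: (@le_trans _ _ ((1 + c / 8) ^+ 8)); first by rewrite /c; lra.
  rewrite [leRHS](_ : _ = expR (c / 8) ^+ 8).
    by rewrite lerXn2r ?nnegrE ?expR_ge0 ?expR_ge1Dx// /c; lra.
  by rewrite -expRM_natl; congr expR; field.
apply: (@le_trans _ _ (expR (r%:R * c) * expR (- x))).
  by rewrite ler_wpM2r ?expR_ge0// expRM_natl lerXn2r ?nnegrE ?expR_ge0.
rewrite -expRD ler_expR.
have : r%:R * c <= x * c by rewrite ler_wpM2r// /c; lra.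
rewrite /c; lra.
Qed.

Theorem corollary2 (R : realType) (nx : nat)
    (PW : probability (nx.-tuple R * R)%type R)
    (T sigma : nx.-tuple R -> R) (eps delta : R) (N r : nat) :
  (1 <= nx)%N ->
  measurable_fun [set: nx.-tuple R] T ->
  measurable_fun [set: nx.-tuple R] sigma ->
  (forall x, 0 < sigma x) ->
  0 < eps < 1 ->
  0 < delta < 1 ->
  (747%:R / 100%:R) / eps * ln (1 / delta) <= N%:R ->
  r%:Z = Num.floor (eps * N%:R / 2%:R) ->
  (1 <= r)%N ->
  ((1 - delta)%:E <=
   power_probability PW N
     [set s : N.-tuple (nx.-tuple R * R) |
        let gammabar :=
          rmax r [seq (`|w.2 - T w.1| / sigma w.1)%R
                   | w : nx.-tuple R * R <- s] in
        PW [set w : nx.-tuple R * R |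
              (gammabar * sigma w.1 < `|w.2 - T w.1|)%R] <= eps%:E])%E.
Proof.
move=> _ mT msigma sigma0 eps01 /andP[delta0 delta1] leN rE r1.
have /andP[eps0 eps1] := eps01.
pose gamma (w : nx.-tuple R * R) : R := `|w.2 - T w.1| / sigma w.1.
have mgamma : measurable_fun setT gamma.
  apply: measurable_funM.
    apply: measurableT_comp; first exact: normr_measurable.
    by apply: measurable_funB => //; exact: measurableT_comp.
  (* Positivity of [sigma] turns the inverse into a real power, which is a measurable function. *)
  rewrite [X in measurable_fun _ X](_ : _ = (fun w => sigma w.1 `^ (-1))).
    apply: (measurableT_comp (measurable_powR _)).
    exact: measurableT_comp.
  by apply/funext => w; rewrite powR_inv1// ltW.
pose H := isMeasurableFun.Build _ _ _ _ gamma mgamma.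
pose X : {RV PW >-> R} := HB.pack gamma H.
have [q qP qeps] := ccdf_upper_quantile _ _ _ PW X _ eps01.
pose A w := q <= gamma w.
have mA : measurable [set w | A w].
  rewrite (_ : mkset _ = X @^-1` `[q, +oo[); first exact: measurable_funPTI.
  by apply/seteqP; split=> w /=; rewrite in_itv/= andbT.
have rN2 : r%:R <= eps * N%:R / 2 :> R.
  have := ge_floor (eps * N%:R / 2); rewrite -rE; exact.
have rN : (r <= N)%N.
  rewrite -(ler_nat R) (le_trans rN2)//.
  have := ler0n R N; nra.
(* Each inclusion uses one half of [count_gt_rmax]. If [q <= g], the [r] or more values at least [g]
   are also at least [q]. If [g < q], then [r] values at least [q] would all exceed [g], but fewer
   than [r] can. *)
rewrite [X in power_probability _ _ X](_ : _ =
    ~` [set s : N.-tuple _ | (count A s < r)%N]); last first.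
  apply/seteqP; split=> s /=.
    set g := rmax r _.
    rewrite (_ : mkset _ = X @^-1` `]g, +oo[); last first.
      by apply/seteqP; split=> w /=; rewrite in_itv/= andbT ltr_pdivlMr.
    rewrite -[PW _]/(ccdf X g) qP => qg; apply/negP; rewrite -leqNgt.
    have [|_] := @count_gt_rmax R r [seq gamma w | w <- s].
      by rewrite r1 size_map size_tuple.
    move=> /leq_trans; apply; rewrite count_map; apply: sub_count => w /=.
    exact: le_trans.
  move=> /negP; rewrite -leqNgt => rA.
  set g := rmax r _.
  rewrite (_ : mkset _ = X @^-1` `]g, +oo[); last first.
    by apply/seteqP; split=> w /=; rewrite in_itv/= andbT ltr_pdivlMr.
  rewrite -[PW _]/(ccdf X g) qP leNgt; apply/negP => gq.
  have [|+ _] := @count_gt_rmax R r [seq gamma w | w <- s].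
    by rewrite r1 size_map size_tuple.
  rewrite ltnNge => /negP; apply; apply: leq_trans rA _.
  by rewrite count_map; apply: sub_count => w /=; exact: lt_le_trans.
rewrite probability_setC; last exact: measurable_count_lt.
rewrite EFinB leeB//.
apply: (le_trans (power_probability_count_lt _ _ _ PW A N r mA)).
rewrite lee_fin.
have : eps <= fine (PW [set w | A w]).
  by rewrite -lee_fin fineK// fin_num_measure.
have : fine (PW [set w | A w]) <= 1.
  by rewrite -lee_fin fineK ?fin_num_measure// probability_le1.
move: (fine _) => p p1 epsp.
apply: (@le_trans _ _ (2 ^+ r * expR (- (eps * N%:R / 2)))).
  rewrite ler_wpM2l ?exprn_ge0//.
  (* Here [1 - p / 2 <= 1 - eps / 2 <= expR (- (eps / 2))]; the bound [p <= 1] keeps the base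
     nonnegative, so that powers preserve the order. *)
  apply: (@le_trans _ _ (expR (- (eps / 2)) ^+ N)).
    rewrite lerXn2r ?nnegrE ?expR_ge0//; first lra.
    by apply: le_trans (expR_ge1Dx _); lra.
  by rewrite -expRM_natl ler_expR; lra.
apply: (le_trans (expr2_mul_expRN_le _ _ _ rN2)).
(* With [delta] written as [expR (ln delta)], the comparison of exponents is the sample-size
   hypothesis multiplied by [eps]. *)
rewrite -[leRHS]lnK ?posrE// ler_expR.
move: leN; rewrite div1r lnV ?posrE// mulrAC ler_pdivrMr//.
lra.
Qed.
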